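(* Let $G$ be a simple connected undirected graph with $n\ge 2$ vertices and average resistance degrees $\overline{R}_1,\dots,\overline{R}_n$. Then $$\rho_1(G)\ge\min_{i\ne j}\sqrt{\overline{R}_i\,\overline{R}_j},$$ and equality holds if and only if $G$ is pseudo resistance regular.
   Context: For a connected graph $G$ with vertices $v_1,\dots,v_n$, Laplacian matrix $L$ (degree matrix minus adjacency matrix) and Moore-Penrose inverse $L^\dagger=(l^\dagger_{ij})$, the resistance distance is $r_{ij}=l^\dagger_{ii}+l^\dagger_{jj}-2l^\dagger_{ij}$, and the resistance distance matrix is $R(G)=(r_{ij})_{n\times n}$. The resistance degrees are $R_i=\sum_{j=1}^n r_{ij}$, the second resistance degrees are $T_i=\sum_{j=1}^n r_{ij}R_j$, and the average resistance degrees are $\overline{R}_i=T_i/R_i$. $G$ is pseudo resistance regular if there is a constant $k$ with $T_i/R_i=k$ for all $i$. The resistance spectral radius $\rho_1(G)$ is the largest eigenvalue of $R(G)$ (equivalently, the maximum of the absolute values of its eigenvalues). The minimum is over $i,j\in\{1,\dots,n\}$ with $i\ne j$. *)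

(* Defs.v *)
From HB Require Import structures.
From mathcomp Require Import all_boot all_order all_algebra.
From mathcomp Require Import boolp classical_sets reals.
From mathcomp Require Import spectral polyrcf complex.

Set Implicit Arguments.
Unset Strict Implicit.
Unset Printing Implicit Defensive.

Import Order.TTheory GRing.Theory Num.Theory.

Local Open Scope ring_scope.

(* The four Penrose equations; over the reals the conjugate transpose is the
   transpose. *)
Definition is_moore_penrose (R : realFieldType) (m n : nat)
    (A : 'M[R]_(m, n)) (X : 'M[R]_(n, m)) : bool :=
  [&& A *m X *m A == A, X *m A *m X == X,
      (A *m X)^T == A *m X & (X *m A)^T == X *m A].

Lemma gram_unitmx (R : realFieldType) (m n : nat) (F : 'M[R]_(m, n)) :
  row_free F -> F *m F^T \in unitmx.
Proof.
move=> Ffree; rewrite -row_free_unit; apply: inj_row_free => v.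
rewrite mulmxA => vFF; have {}vFF : (v *m F) *m (v *m F)^T = 0.
  by rewrite trmx_mul mulmxA vFF mul0mx.
apply: (row_free_inj Ffree); rewrite mul0mx.
apply/rowP=> j; move/matrixP/(_ 0 0)/eqP: vFF.
rewrite [X in X == _]mxE [X in _ == X]mxE.
rewrite psumr_eq0 => [/allP/(_ j)|k _]; rewrite [X in _ * X]mxE -expr2.
  by rewrite mem_index_enum sqrf_eq0 [RHS]mxE => /(_ isT)/eqP.
exact: sqr_ge0.
Qed.

(* Witness obtained from the full-rank factorization A = C *m F. *)
Lemma moore_penrose_exists (R : realFieldType) (m n : nat) (A : 'M[R]_(m, n)) :
  exists X, is_moore_penrose A X.
Proof.
have Fu := gram_unitmx (row_base_free A).
have Cu : (col_base A)^T *m col_base A \in unitmx.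
  rewrite -[X in _ *m X]trmxK; apply: gram_unitmx.
  by rewrite /row_free mxrank_tr; apply: col_base_full.
move: (mulmx_base A) Fu Cu; move: (col_base A) (row_base A) => C F.
move: (\rank A) C F => r C F <- Fu Cu {A}.
pose G := F^T *m invmx (F *m F^T); pose H := invmx (C^T *m C) *m C^T.
have FG : F *m G = 1%:M by rewrite /G mulmxA mulmxV.
have HC : H *m C = 1%:M by rewrite /H -mulmxA mulVmx.
have AX : C *m F *m (G *m H) = C *m H by rewrite -mulmxA (mulmxA F) FG mul1mx.
have XA : G *m H *m (C *m F) = G *m F by rewrite -mulmxA (mulmxA H) HC mul1mx.
exists (G *m H); apply/and4P; split; apply/eqP.
- by rewrite AX -mulmxA (mulmxA H) HC mul1mx.
- by rewrite XA -mulmxA (mulmxA F) FG mul1mx.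
- by rewrite AX /H !trmx_mul trmxK trmx_inv trmx_mul trmxK mulmxA.
- by rewrite XA /G !trmx_mul trmxK trmx_inv trmx_mul trmxK mulmxA.
Qed.

Definition mpinv (R : realFieldType) (m n : nat) (A : 'M[R]_(m, n)) :
    'M[R]_(n, m) :=
  xchoose (moore_penrose_exists A).

Lemma mpinvP (R : realFieldType) (m n : nat) (A : 'M[R]_(m, n)) :
  is_moore_penrose A (mpinv A).
Proof. exact: xchooseP. Qed.

Lemma moore_penrose_uniq (R : realFieldType) (m n : nat) (A : 'M[R]_(m, n))
    (X Y : 'M[R]_(n, m)) :
  is_moore_penrose A X -> is_moore_penrose A Y -> X = Y.
Proof.
move=> /and4P[/eqP AXA /eqP XAX /eqP AXs /eqP XAs].
move=> /and4P[/eqP AYA /eqP YAY /eqP AYs /eqP YAs].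
have AXY : A *m X = A *m Y.
  by rewrite -AXs -{1}AYA -(mulmxA (A *m Y)) trmx_mul AXs AYs mulmxA AXA.
have XYA : X *m A = Y *m A.
  rewrite -XAs -[in LHS]AYA -(mulmxA A) mulmxA trmx_mul XAs YAs.
  by rewrite -(mulmxA Y) (mulmxA A) AXA.
by rewrite -XAX XYA -mulmxA AXY mulmxA YAY.
Qed.

Lemma mpinv_tr (R : realFieldType) (m n : nat) (A : 'M[R]_(m, n)) :
  mpinv A^T = (mpinv A)^T.
Proof.
apply: (moore_penrose_uniq (mpinvP _)).
have /and4P[/eqP AXA /eqP XAX /eqP AXs /eqP XAs] := mpinvP A.
apply/and4P; split; apply/eqP; rewrite -!trmx_mul ?mulmxA //.
- by rewrite AXA.
- by rewrite XAX.
- by rewrite XAs.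
- by rewrite AXs.
Qed.

Definition max_eigenvalue (R : realType) (n : nat) (A : 'M[R]_n) : R :=
  sup [set a : R | eigenvalue A a]%classic.

Lemma sup_maxE (R : realType) (E : set R) (m : R) :
  E m -> (forall x, E x -> x <= m) -> sup E = m.
Proof.
move=> Em leEm; apply/le_anti/andP; split; first by apply: ge_sup => //; exists m.
by apply: ub_le_sup => //; exists m.
Qed.

Lemma symmetric_has_eigenvalue (R : realType) (n : nat) (A : 'M[R]_n) :
  (0 < n)%N -> A^T = A -> exists a : R, eigenvalue A a.
Proof.
move=> n_gt0 symA; pose f := @real_complex R.
pose Ac := map_mx f A.
have [a a_eig] : exists a, eigenvalue Ac a.
  apply/eigenvalue_closed => //.
have [v vA v0] := eigenvalueP a_eig.
have hermA : map_mx Num.conj Ac^T = Ac.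
  by apply/matrixP => i j; rewrite !mxE -[in LHS]symA mxE; apply: conjc_real.
have norm_v : (v *m map_mx Num.conj v^T) 0 0 != 0.
  apply: contra v0; rewrite mxE psumr_eq0; last first.
    by move=> k _; rewrite !mxE -normCK exprn_ge0.
  move=> /allP v0; apply/eqP/rowP => k; apply/eqP.
  by have := v0 k; rewrite mem_index_enum !mxE -normCK sqrf_eq0 normr_eq0; apply.
have aR : a^* = a.
  apply: (mulIf norm_v).
  have /(congr1 (fun w => (w *m map_mx Num.conj v^T) 0 0)) := vA.
  rewrite -scalemxAl [in RHS]mxE => <-.
  have /(congr1 (fun w => (v *m map_mx Num.conj w^T) 0 0)) := vA.
  rewrite trmx_mul map_mxM hermA mulmxA => ->.
  by rewrite linearZ /= map_mxZ -scalemxAr [in RHS]mxE.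
have [b ab] : exists b : R, a = f b.
  case: a aR {a_eig vA} => x y [] /eqP; rewrite eqNr => /eqP ->.
  by exists x.
exists b; move: a_eig.
by rewrite ab !eigenvalue_root_char -map_char_poly fmorph_root.
Qed.

(* For a symmetric real matrix of positive size the supremum is attained. *)
Lemma max_eigenvalueP (R : realType) (n : nat) (A : 'M[R]_n) :
  (0 < n)%N -> A^T = A ->
  eigenvalue A (max_eigenvalue A) /\
  (forall a : R, eigenvalue A a -> a <= max_eigenvalue A).
Proof.
move=> n_gt0 symA; have [a0 a0_eig] := symmetric_has_eigenvalue n_gt0 symA.
have p0 : char_poly A != 0 by rewrite monic_neq0 ?char_poly_monic.
pose s := rootsR (char_poly A).
have sE a : eigenvalue A a = (a \in s).
  have := roots_on_rootsR p0 a.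
  by rewrite eigenvalue_root_char inE /= => <-.
have s_lt i : (i < size s)%N -> eigenvalue A s`_i by move=> ?; rewrite sE mem_nth.
have a0s : (index a0 s < size s)%N by rewrite index_mem -sE.
case: (@arg_maxP _ _ _ (Ordinal a0s) xpredT (fun i : 'I_(size s) => s`_i)) => // i _ ile.
have le_i x : eigenvalue A x -> x <= s`_i.
  move=> xe; have xs : (index x s < size s)%N by rewrite index_mem -sE.
  by have := ile (Ordinal xs) isT; rewrite /= nth_index // -sE.
have -> : max_eigenvalue A = s`_i by apply: sup_maxE => //; apply: s_lt.
by split=> //; apply: s_lt.
Qed.

Section Resistance.

Variables (R : realType) (n : nat) (e : rel 'I_n).

Definition simple_graph : Prop := symmetric e /\ irreflexive e.

Definition connected_graph : Prop := forall i j : 'I_n, connect e i j.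

Definition adjacency : 'M[R]_n := \matrix_(i, j) (e i j)%:R.

Definition degree_mx : 'M[R]_n := diag_mx (\row_i #|[set j | e i j]|%:R).

Definition laplacian : 'M[R]_n := degree_mx - adjacency.

Definition resistance (i j : 'I_n) : R :=
  mpinv laplacian i i + mpinv laplacian j j - 2%:R * mpinv laplacian i j.

Definition resistance_mx : 'M[R]_n := \matrix_(i, j) resistance i j.

Definition resistance_degree (i : 'I_n) : R := \sum_j resistance i j.

Definition second_resistance_degree (i : 'I_n) : R :=
  \sum_j resistance i j * resistance_degree j.

Definition avg_resistance_degree (i : 'I_n) : R :=
  second_resistance_degree i / resistance_degree i.

Definition pseudo_resistance_regular : Prop :=
  exists k : R, forall i : 'I_n,
    avg_resistance_degree i = k.

Definition resistance_spectral_radius : R := max_eigenvalue resistance_mx.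

(* The infimum of a finite set, which is nonempty when 1 < n: a minimum. *)
Definition min_sqrt_avg_resistance : R :=
  inf [set x : R | exists i j : 'I_n, i != j /\
    x = Num.sqrt (avg_resistance_degree i * avg_resistance_degree j)]%classic.

End Resistance.

Lemma resistance_mx_sym (R : realType) (n : nat) (e : rel 'I_n) :
  symmetric e -> (resistance_mx R e)^T = resistance_mx R e.
Proof.
move=> sym_e; have symL : (laplacian R e)^T = laplacian R e.
  rewrite /laplacian linearB /= tr_diag_mx; congr (_ - _).
  by apply/matrixP => i j; rewrite !mxE sym_e.
apply/matrixP => i j; rewrite !mxE /resistance.
rewrite -[X in mpinv X j i]symL mpinv_tr mxE.
by rewrite [X in X - _]addrC.
Qed.

Lemma min_sqrt_avg_resistanceP (R : realType) (n : nat) (e : rel 'I_n) :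
  (1 < n)%N ->
  (exists i j : 'I_n, i != j /\ min_sqrt_avg_resistance R e =
     Num.sqrt (avg_resistance_degree R e i * avg_resistance_degree R e j)) /\
  (forall i j : 'I_n, i != j -> min_sqrt_avg_resistance R e <=
     Num.sqrt (avg_resistance_degree R e i * avg_resistance_degree R e j)).
Proof.
move=> n_gt1; pose d := avg_resistance_degree R e.
pose F (p : 'I_n * 'I_n) := Num.sqrt (d p.1 * d p.2).
pose p0 := (Ordinal (ltnW n_gt1), Ordinal n_gt1).
case: (@arg_minP _ _ _ p0 (fun p => p.1 != p.2) F) => // -[i j] /= ij leF.
have infE : min_sqrt_avg_resistance R e = F (i, j).
  apply/le_anti/andP; split.
    apply: ge_inf; last by exists i, j.
    by exists (F (i, j)) => _ [k [l [kl ->]]]; apply: (leF (k, l)).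
  apply: lb_le_inf; first by exists (F (i, j)), i, j.
  by move=> _ [k [l [kl ->]]]; apply: (leF (k, l)).
split; first by exists i, j.
by move=> k l kl; rewrite infE; apply: (leF (k, l)).
Qed.

(* Main.v *)
Require Import Defs.
From mathcomp Require Import all_boot all_order all_algebra.
From mathcomp Require Import reals.
From mathcomp Require Import spectral complex.
From mathcomp Require Import ring lra.

(** The resistance matrix [A] of a connected graph is symmetric with zero
diagonal and positive entries elsewhere: the Laplacian is positive
semidefinite with kernel the constant vectors, so its Moore-Penrose inverse
[X] is positive semidefinite with the same kernel, and
[resistance i j = (e_i - e_j) X (e_i - e_j)^T] is positive because
[e_i - e_j] is not constant ([resistance_gt0]).

By the spectral theorem, the largest eigenvalue [rho] of [A] is the maximum of
its Rayleigh quotient ([max_eigenvalue_psd]).  Taking absolute values of the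
entries of an eigenvector does not decrease the Rayleigh quotient, which gives
a positive eigenvector [z] for [rho] ([perron_vector]).

Let [x] be the vector of resistance degrees, so that [(A x)_i = d_i x_i] with
[d_i] the average resistance degrees, and let [y_i = z_i / x_i].  Let [s]
minimize [y], and let [t] minimize [y] over the indices other than [s].  As
[A s s = 0], row [s] of [A z = rho z] only involves the [y_j] with [j != s],
whence [rho y_s >= d_s y_t]; row [t] gives [rho y_t >= d_t y_s].  Multiplying,
[rho ^+ 2 >= d_s d_t] ([two_smallest_bound]), which is the inequality.

If equality holds, it holds in both rows, so [y_j = y_t] for [j != s] and
[y_j = y_s] for [j != t].  Either [y] is constant, and then [d_i = rho] for
all [i], or the graph has only the two vertices [s] and [t], and then
[d_s = d_t] ([two_vertices_regular]).  Conversely, if [d] is constant, equal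
to [k], then pairing [A x = k x] with [z] gives [rho = k]. *)

Set Implicit Arguments.
Unset Strict Implicit.
Unset Printing Implicit Defensive.

Import Order.TTheory GRing.Theory Num.Theory.

Local Open Scope ring_scope.

(** * Positive semidefinite matrices *)

(** The quadratic form of [M] at the row vector [v]. *)
Definition qform (R : pzRingType) (n : nat) (M : 'M[R]_n) (v : 'rV[R]_n) : R :=
  (v *m M *m v^T) 0 0.

(** Nonnegativity of the quadratic form; symmetry of [M] is not included. *)
Definition psdmx (R : realFieldType) (n : nat) (M : 'M[R]_n) : Prop :=
  forall v, 0 <= qform M v.

Lemma qformE (R : comPzRingType) (n : nat) (M : 'M[R]_n) (v : 'rV[R]_n) :
  qform M v = \sum_i \sum_j M i j * (v 0 i * v 0 j).
Proof.
rewrite /qform mxE exchange_big; apply: eq_bigr => j _; rewrite !mxE mulr_suml.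
by apply: eq_bigr => i _; ring.
Qed.

Lemma qform1 (R : comPzRingType) (n : nat) (v : 'rV[R]_n) :
  qform 1%:M v = \sum_i v 0 i ^+ 2.
Proof. by rewrite /qform mulmx1 mxE; apply: eq_bigr => i _; rewrite mxE. Qed.

Lemma row_sqr_eq0 (R : realFieldType) (n : nat) (v : 'rV[R]_n) :
  (v *m v^T) 0 0 = 0 -> v = 0.
Proof.
rewrite mxE => /eqP; rewrite psumr_eq0 => [/allP v0|k _]; last first.
  by rewrite mxE -expr2 sqr_ge0.
apply/rowP => k; apply/eqP; have := v0 k (mem_index_enum k).
by rewrite !mxE -expr2 sqrf_eq0.
Qed.

(** The quadratic form of a symmetric positive semidefinite matrix only
vanishes on the kernel: otherwise it would take a negative value on
the line through [v] directed by [v *m M]. *)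
Lemma psdmx_kernel (R : realFieldType) (n : nat) (M : 'M[R]_n) (v : 'rV[R]_n) :
  M^T = M -> psdmx M -> qform M v = 0 -> v *m M = 0.
Proof.
move=> symM psdM v0; apply: row_sqr_eq0.
set u := v *m M; set q := (u *m u^T) 0 0.
have q_ge0 : 0 <= q.
  by rewrite /q mxE sumr_ge0 // => i _; rewrite [X in _ * X]mxE -expr2 sqr_ge0.
have c_ge0 := psdM u; set c := qform M u in c_ge0.
(* On the line, the form is 2 * t * q + t ^+ 2 * c, which is negative at this
   t unless q = 0; the denominator c + 1 avoids the case c = 0. *)
pose t := - (q / (c + 1)).
have expand : qform M (v + t *: u) = 2 * t * q + t ^+ 2 * c.
  have -> : qform M (v + t *: u) =
      qform M v + t * (v *m M *m u^T) 0 0 + t * (u *m M *m v^T) 0 0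
      + t ^+ 2 * qform M u.
    rewrite /qform linearD /= linearZ /= !mulmxDl !mulmxDr -!scalemxAl.
    rewrite -!scalemxAr.
    by rewrite !mxE; ring.
  have -> : (u *m M *m v^T) 0 0 = q.
    by rewrite -mulmxA -{1}symM -trmx_mul.
  by rewrite v0 -/u -/q -/c; ring.
have := psdM (v + t *: u); rewrite expand.
have c1 : 0 < c + 1 by lra.
have -> : 2 * t * q + t ^+ 2 * c = - (q / (c + 1)) ^+ 2 * (c + 2).
  by rewrite /t; field; rewrite gt_eqF.
move=> h; have : (q / (c + 1)) ^+ 2 <= 0 by nra.
rewrite real_exprn_even_le0 ?num_real //= mulf_eq0 invr_eq0 (gt_eqF c1) orbF.
by move/eqP.
Qed.

(** * The largest eigenvalue of a symmetric matrix *)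

(** The largest eigenvalue bounds the Rayleigh quotient.  The complexification
of [A] is Hermitian, hence unitarily diagonalizable with real eigenvalues,
which are eigenvalues of [A]. *)
Lemma max_eigenvalue_psd (R : realType) (n : nat) (A : 'M[R]_n) :
  A^T = A -> psdmx ((max_eigenvalue A)%:M - A).
Proof.
move=> symA v; set m := max_eigenvalue A.
pose f := @real_complex R; pose Ac := map_mx f A; pose vc := map_mx f v.
have conjf (p q : nat) (B : 'M[R]_(p, q)) :
    map_mx Num.conj (map_mx f B) = map_mx f B.
  by apply/matrixP => i j; rewrite !mxE; apply: conjc_real.
have Aherm : Ac \is hermsymmx.
  by apply/is_hermitianmxP; rewrite expr0 scale1r -map_trmx conjf map_trmx symA.
have /orthomx_spectralP := hermitian_normalmx Aherm.
have := hermitian_spectral_diag_real Aherm.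
have Pu := spectral_unitarymx Ac.
rewrite invmx_unitary //.
move: Pu; set P := spectralmx Ac; set d := spectral_diag Ac.
move=> Pu dreal Adiag.
have PP : P *m map_mx Num.conj P^T = 1%:M by apply/unitarymxP.
have PP' : map_mx Num.conj P^T *m P = 1%:M by apply: mulmx1C.
have PA : P *m Ac = diag_mx d *m P.
  by rewrite Adiag !mulmxA PP mul1mx.
(* The rows of P are eigenvectors of Ac. *)
have d_le k : d 0 k <= f m.
  have /complex_realP[b db] : d 0 k \is Num.real by apply: (mxOverP dreal).
  rewrite db lecR; apply: (max_eigenvalueP _ symA).2.
    exact: leq_ltn_trans (ltn_ord k).
  suff : eigenvalue Ac (f b).
    by rewrite !eigenvalue_root_char -map_char_poly fmorph_root.
  apply/eigenvalueP; exists (row k P).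
    by apply/rowP => j; rewrite -row_mul PA mul_diag_mx !mxE db.
  apply/eqP => row0; have /rowP/(_ k)/eqP := row_mul k P (map_mx Num.conj P^T).
  by rewrite PP row0 mul0mx !mxE eqxx oner_eq0.
(* The coordinates of v in the orthonormal basis of eigenvectors. *)
pose w := vc *m map_mx Num.conj P^T.
suff qw : f (qform (m%:M - A) v) = \sum_k (f m - d 0 k) * (w 0 k * (w 0 k)^*).
  rewrite -ler0c -[X in _ <= X]/(f _) qw sumr_ge0 // => k _.
  by rewrite mulr_ge0 ?subr_ge0 // -normCK exprn_ge0.
have -> : f (qform (m%:M - A) v) = qform ((f m)%:M - Ac) vc.
  by rewrite /qform /vc map_trmx -map_scalar_mx -map_mxB -!map_mxM [RHS]mxE.
have -> : (f m)%:M - Ac = map_mx Num.conj P^T *m ((f m)%:M - diag_mx d) *m P.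
  by rewrite mulmxBr mulmxBl -Adiag mul_mx_scalar -scalemxAl PP' scalemx1.
have trw : P *m vc^T = map_mx Num.conj w^T.
  by rewrite /w trmx_mul map_mxM trmxCK -[in RHS]map_trmx conjf.
rewrite /qform !mulmxA -/w -mulmxA trw mxE; apply: eq_bigr => k _.
rewrite mulmxBr mul_mx_scalar mul_mx_diag.
rewrite !mxE. ring.
Qed.

(** The part of the Perron-Frobenius theorem that is needed: a symmetric matrix
with nonnegative entries, positive off the diagonal, has a positive eigenvector
for its largest eigenvalue. *)
Lemma perron_vector (R : realType) (n : nat) (A : 'M[R]_n) :
  (0 < n)%N -> A^T = A -> (forall i j, 0 <= A i j) ->
  (forall i j, i != j -> 0 < A i j) ->
  exists2 z : 'rV[R]_n, z *m A = max_eigenvalue A *: z & forall i, 0 < z 0 i.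
Proof.
move=> n_gt0 symA A_ge0 A_gt0; set rho := max_eigenvalue A.
have psdM : psdmx (rho%:M - A) := max_eigenvalue_psd symA.
have symM : (rho%:M - A)^T = rho%:M - A by rewrite linearB /= tr_scalar_mx symA.
have [/eigenvalueP[v vA v0] _] := max_eigenvalueP n_gt0 symA.
pose z : 'rV[R]_n := \row_i `|v 0 i|.
have qM u : qform (rho%:M - A) u = rho * qform 1%:M u - qform A u.
  rewrite /qform mulmxBr mulmxBl mul_mx_scalar mulmx1 -scalemxAl.
  by rewrite mxE [X in X + _]mxE [X in _ + X]mxE.
have z_max : qform (rho%:M - A) z <= 0.
  have <- : qform (rho%:M - A) v = 0.
    by rewrite /qform mulmxBr mul_mx_scalar vA subrr mul0mx mxE.
  rewrite !qM !qform1 lerB //.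
    rewrite le_eqVlt; apply/orP; left; apply/eqP; congr (_ * _).
    by apply: eq_bigr => i _; rewrite mxE real_normK ?num_real.
  rewrite !qformE; apply: ler_sum => i _; apply: ler_sum => j _.
  by rewrite !mxE ler_wpM2l // -normrM ler_norm.
have zA : z *m A = rho *: z.
  have /eqP : z *m (rho%:M - A) = 0.
    by apply: psdmx_kernel => //; apply/le_anti; rewrite z_max psdM.
  by rewrite mulmxBr mul_mx_scalar subr_eq0 => /eqP.
(* If z i = 0, coordinate i of the eigenvector equation forces z = 0. *)
exists z => // i; rewrite mxE normr_gt0; apply: contraNneq v0 => vi0.
have /rowP/(_ i) := zA; rewrite !mxE vi0 normr0 mulr0 => /eqP.
rewrite psumr_eq0 => [/allP zA0|j _]; last by rewrite mxE mulr_ge0.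
apply/eqP/rowP => j; rewrite [RHS]mxE; have [->//|ji] := eqVneq j i.
have := zA0 j (mem_index_enum j); rewrite mxE mulf_eq0 normr_eq0.
by rewrite (gt_eqF (A_gt0 _ _ ji)) orbF => /eqP.
Qed.

(** * Bounds on an eigenvalue with a positive eigenvector *)

Section QuotientBound.

Variables (R : realFieldType) (n : nat) (A : 'M[R]_n) (rho : R).
(* The eigenvector is written x y, entrywise. *)
Variables x y d : 'I_n -> R.
Hypothesis A_diag : forall i, A i i = 0.
Hypothesis A_gt0 : forall i j, i != j -> 0 < A i j.
Hypothesis x_gt0 : forall i, 0 < x i.
Hypothesis y_gt0 : forall i, 0 < y i.
Hypothesis Ax : forall i, \sum_j A i j * x j = d i * x i.
Hypothesis Axy : forall i, \sum_j A i j * (x j * y j) = rho * (x i * y i).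

(** As the diagonal entry vanishes, row [i] of the eigenvector equation only
involves the [y j] with [j != i]. *)
Lemma row_quotient_bound (c : R) (i : 'I_n) :
  (forall j, j != i -> c <= y j) ->
  c * d i <= rho * y i /\ (rho * y i = c * d i -> forall j, j != i -> y j = c).
Proof.
move=> c_le.
have gap : x i * (rho * y i - c * d i) = \sum_j A i j * x j * (y j - c).
  transitivity (rho * (x i * y i) - c * (d i * x i)); first by ring.
  rewrite -Ax -Axy mulr_sumr -sumrB; apply: eq_bigr => j _; ring.
have gap_ge0 j : 0 <= A i j * x j * (y j - c).
  have [->|ji] := eqVneq j i; first by rewrite A_diag !mul0r.
  by rewrite !mulr_ge0 ?subr_ge0 ?c_le // ltW ?A_gt0 // eq_sym.
split; first by rewrite -subr_ge0 -(pmulr_rge0 _ (x_gt0 i)) gap sumr_ge0.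
move=> eq_c j ji; move/eqP: gap; rewrite eq_c subrr mulr0 eq_sym.
rewrite psumr_eq0 => // /allP/(_ j (mem_index_enum j)).
have Aij : 0 < A i j by rewrite A_gt0 // eq_sym.
by rewrite !mulf_eq0 (gt_eqF (x_gt0 j)) (gt_eqF Aij) subr_eq0 => /eqP.
Qed.

(** The value [y s] is the smallest, and [y t] bounds all the others from
below; the bound is the product of the bounds for rows [s] and [t]. *)
Lemma two_smallest_bound (s t : 'I_n) :
  (forall i, y s <= y i) -> (forall i, i != s -> y t <= y i) ->
  0 <= d s -> 0 < d t ->
  [/\ 0 < rho, d s * d t <= rho ^+ 2 &
    rho ^+ 2 = d s * d t ->
    (forall j, j != s -> y j = y t) /\ (forall j, j != t -> y j = y s)].
Proof.
move=> s_min t_min ds dt.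
have [s_le s_eq] := row_quotient_bound t_min.
have [t_le t_eq] := row_quotient_bound (fun j (_ : j != t) => s_min j).
have ys := y_gt0 s; have yt := y_gt0 t.
have rho_gt0 : 0 < rho.
  by rewrite -(pmulr_lgt0 _ yt); apply: lt_le_trans t_le; rewrite mulr_gt0.
have rs : 0 < rho * y s by rewrite mulr_gt0.
have yd : 0 < y s * d t by rewrite mulr_gt0.
split=> //.
  rewrite -(ler_pM2l (mulr_gt0 ys yt)).
  have -> : y s * y t * (d s * d t) = (y t * d s) * (y s * d t) by ring.
  have -> : y s * y t * rho ^+ 2 = (rho * y s) * (rho * y t) by ring.
  by rewrite ler_pM // ?mulr_ge0 // ltW.
move=> eq_rho; split.
  apply: s_eq; apply/le_anti; rewrite s_le andbT.
  rewrite -(ler_pM2r yd).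
  have -> : y t * d s * (y s * d t) = (rho * y s) * (rho * y t).
    transitivity (y s * y t * (d s * d t)); first by ring.
    by rewrite -eq_rho; ring.
  by rewrite ler_pM2l.
apply: t_eq; apply/le_anti; rewrite t_le andbT.
rewrite -(ler_pM2l rs).
have -> : rho * y s * (rho * y t) = (y t * d s) * (y s * d t).
  transitivity (y s * y t * rho ^+ 2); first by ring.
  by rewrite eq_rho; ring.
by rewrite ler_pM2r.
Qed.

End QuotientBound.

(** * Positivity of the resistance distance *)

Lemma laplacian_sym (R : realType) (n : nat) (e : rel 'I_n) :
  symmetric e -> (laplacian R e)^T = laplacian R e.
Proof.
move=> sym_e; rewrite /laplacian linearB /= tr_diag_mx; congr (_ - _).
by apply/matrixP => i j; rewrite !mxE sym_e.
Qed.

(** The factor 2 appears because each edge is counted in both directions. *)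
Lemma laplacian_qform (R : realType) (n : nat) (e : rel 'I_n) (v : 'rV[R]_n) :
  symmetric e ->
  2 * qform (laplacian R e) v =
    \sum_i \sum_j (e i j)%:R * (v 0 i - v 0 j) ^+ 2.
Proof.
move=> sym_e.
have degree_sum : qform (degree_mx R e) v =
    \sum_i \sum_j (e i j)%:R * v 0 i ^+ 2.
  rewrite /qform mul_mx_diag mxE; apply: eq_bigr => i _; rewrite !mxE.
  have -> : #|[set j | e i j]|%:R = \sum_j (e i j)%:R :> R.
    rewrite -sum1_card natr_sum big_mkcond; apply: eq_bigr => j _.
    by rewrite inE; case: (e i j).
  by rewrite -mulr_suml; ring.
have degree_sum' : qform (degree_mx R e) v =
    \sum_i \sum_j (e i j)%:R * v 0 j ^+ 2.
  rewrite degree_sum exchange_big; apply: eq_bigr => i _.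
  by apply: eq_bigr => j _; rewrite sym_e.
have -> : qform (laplacian R e) v =
    qform (degree_mx R e) v - qform (adjacency R e) v.
  by rewrite /qform mulmxBr mulmxBl mxE [X in _ + X]mxE.
transitivity (qform (degree_mx R e) v + qform (degree_mx R e) v -
    2 * qform (adjacency R e) v); first by ring.
rewrite {1}degree_sum degree_sum' qformE mulr_sumr -big_split -sumrB /=.
apply: eq_bigr => i _; rewrite mulr_sumr -big_split -sumrB /=.
by apply: eq_bigr => j _; rewrite mxE; ring.
Qed.

Lemma laplacian_psd (R : realType) (n : nat) (e : rel 'I_n) :
  symmetric e -> psdmx (laplacian R e).
Proof.
move=> sym_e v; rewrite -(pmulr_rge0 _ (ltr0n R 2)) laplacian_qform //.
by apply: sumr_ge0 => i _; apply: sumr_ge0 => j _; rewrite mulr_ge0 ?sqr_ge0.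
Qed.

Lemma laplacian_kernel (R : realType) (n : nat) (e : rel 'I_n) (v : 'rV[R]_n) :
  symmetric e -> connected_graph e -> v *m laplacian R e = 0 ->
  forall i j, v 0 i = v 0 j.
Proof.
move=> sym_e conn_e vL.
have edge_eq i j : e i j -> v 0 i = v 0 j.
  have := laplacian_qform v sym_e.
  rewrite /qform vL mul0mx mxE mulr0 => /esym/eqP.
  have term_ge0 k l : 0 <= (e k l)%:R * (v 0 k - v 0 l) ^+ 2.
    by rewrite mulr_ge0 ?sqr_ge0.
  rewrite psumr_eq0 => [/allP/(_ i (mem_index_enum i))|k _]; last first.
    exact: sumr_ge0.
  rewrite psumr_eq0 => // /allP/(_ j (mem_index_enum j)) /[swap] ->.
  by rewrite mul1r sqrf_eq0 subr_eq0 => /eqP.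
move=> i j; have /connectP[p] := conn_e i j.
elim: p i => [i _ ->//|k p IHp i /= /andP[/edge_eq -> kp]]; exact: IHp.
Qed.

Lemma resistance_gt0 (R : realType) (n : nat) (e : rel 'I_n) (i j : 'I_n) :
  symmetric e -> connected_graph e -> i != j -> 0 < resistance R e i j.
Proof.
move=> sym_e conn_e ij; set L := laplacian R e; set X := mpinv L.
have symL : L^T = L := laplacian_sym R sym_e.
have symX : X^T = X by rewrite -mpinv_tr symL.
have := mpinvP L; rewrite -/X => /and4P[/eqP LXL /eqP XLX _ /eqP XLs].
pose u : 'rV[R]_n := delta_mx 0 i - delta_mx 0 j.
have qXL w : qform X w = qform L (w *m X).
  by rewrite /qform -{1}XLX trmx_mul symX !mulmxA.
have psdX : psdmx X by move=> w; rewrite qXL laplacian_psd.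
have resE : resistance R e i j = qform X u.
  have Xij : X j i = X i j by rewrite -{1}symX mxE.
  have XE (k l : 'I_n) :
      (delta_mx 0 k *m X *m (delta_mx 0 l)^T : 'M_1) 0 0 = X k l.
    by rewrite trmx_delta -rowE -colE !mxE.
  rewrite /resistance /qform -/L -/X linearB /= !mulmxBl !mulmxBr.
  transitivity (X i i - X i j - (X j i - X j j)); first by rewrite Xij; ring.
  by rewrite -!XE !mxE.
rewrite resE lt_neqAle psdX andbT eq_sym; apply/eqP => q0.
(* If the resistance vanishes, u lies in the kernel of X, hence in that of
   L = L X L = X L L, so that u is constant, although u i = 1 and u j = -1. *)
have uX := psdmx_kernel symX psdX q0.
have XLC : L *m X = X *m L by rewrite -XLs trmx_mul symX symL.
have uL : u *m L = 0 by rewrite -LXL XLC !mulmxA uX !mul0mx.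
have := laplacian_kernel sym_e conn_e uL i j.
by rewrite !mxE !eqxx /= (negPf ij) [j == i]eq_sym (negPf ij) /=; lra.
Qed.

(** * The lower bound for the resistance spectral radius *)

Lemma two_vertices_regular (R : realType) (n : nat) (e : rel 'I_n)
    (s t : 'I_n) :
  symmetric e -> s != t -> (forall i, i = s \/ i = t) ->
  avg_resistance_degree R e s = avg_resistance_degree R e t.
Proof.
move=> sym_e st all_st.
have res0 i : resistance R e i i = 0 by rewrite /resistance; ring.
have resC : resistance R e t s = resistance R e s t.
  have := congr1 (fun M : 'M_n => M s t) (resistance_mx_sym R sym_e).
  by rewrite !mxE.
have sumE (F : 'I_n -> R) : \sum_i F i = F s + F t.
  rewrite (bigD1 s) //= (bigD1 t) 1?eq_sym //= big1 ?addr0 //.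
  move=> i /andP[i_s i_t].
  by case: (all_st i) => ii; rewrite ii eqxx in i_s i_t.
rewrite /avg_resistance_degree /second_resistance_degree /resistance_degree.
by rewrite !sumE !res0 resC !mul0r !addr0 !add0r.
Qed.

Theorem theorem4p4 (R : realType) (n : nat) (e : rel 'I_n) :
  (2 <= n)%N -> simple_graph e -> connected_graph e ->
  min_sqrt_avg_resistance R e <= resistance_spectral_radius R e /\
  (resistance_spectral_radius R e = min_sqrt_avg_resistance R e <->
   pseudo_resistance_regular R e).
Proof.
move=> n_gt1 [sym_e _] conn_e; have n_gt0 := ltnW n_gt1.
pose A := resistance_mx R e; pose x := resistance_degree R e.
pose d := avg_resistance_degree R e.
set rho := resistance_spectral_radius R e.
have symA : A^T = A := resistance_mx_sym R sym_e.
have A_diag i : A i i = 0 by rewrite mxE /resistance; ring.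
have A_gt0 i j : i != j -> 0 < A i j by move=> ij; rewrite mxE resistance_gt0.
have A_ge0 i j : 0 <= A i j.
  by have [->|/A_gt0/ltW//] := eqVneq i j; rewrite A_diag.
have other i : exists j : 'I_n, j != i.
  have : (0 < #|predC1 i|)%N by rewrite cardC1 card_ord -subn1 subn_gt0.
  by case/card_gt0P => j; exists j.
have row_sum_gt0 (w : 'I_n -> R) i :
    (forall j, 0 < w j) -> 0 < \sum_j A i j * w j.
  move=> w_gt0; have [j ji] := other i.
  rewrite (bigD1 j) //= ltr_wpDr // ?sumr_ge0 // => [k _|].
    by rewrite mulr_ge0 // ltW.
  by rewrite mulr_gt0 // A_gt0 // eq_sym.
have x_gt0 i : 0 < x i.
  have -> : x i = \sum_j A i j * 1 by apply: eq_bigr => j _; rewrite mxE mulr1.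
  exact: row_sum_gt0.
have T_E i : second_resistance_degree R e i = \sum_j A i j * x j.
  by apply: eq_bigr => j _; rewrite mxE.
have d_gt0 i : 0 < d i by rewrite divr_gt0 // T_E row_sum_gt0.
have Ax i : \sum_j A i j * x j = d i * x i by rewrite -T_E divfK // gt_eqF.
have [z zA z_gt0] := perron_vector n_gt0 symA A_ge0 A_gt0.
have Az i : \sum_j A i j * z 0 j = rho * z 0 i.
  have /rowP/(_ i) := zA; rewrite !mxE => <-; apply: eq_bigr => j _.
  by rewrite -[in LHS]symA mxE mulrC.
pose y i := z 0 i / x i.
have y_gt0 i : 0 < y i by rewrite divr_gt0.
have xy i : x i * y i = z 0 i by rewrite mulrC divfK // gt_eqF.
have Axy i : \sum_j A i j * (x j * y j) = rho * (x i * y i).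
  by rewrite xy -Az; apply: eq_bigr => j _; rewrite xy.
have [s s_min] : exists s, forall i, y s <= y i.
  case: (@arg_minP _ _ _ (Ordinal n_gt0) xpredT y) => // s _ le_s.
  by exists s => i; apply: le_s.
have [t0 t0s] := other s.
have [t ts t_min] : exists2 t, t != s & forall i, i != s -> y t <= y i.
  by case: (@arg_minP _ _ _ t0 (predC1 s) y) => // t ts le_t; exists t.
have [rho_gt0 le_rho eq_rho] :=
  two_smallest_bound A_diag A_gt0 x_gt0 y_gt0 Ax Axy s_min t_min
    (ltW (d_gt0 s)) (d_gt0 t).
have [[a [b [_ minE]]] min_le] := min_sqrt_avg_resistanceP R e n_gt1.
have min_st : min_sqrt_avg_resistance R e <= Num.sqrt (d s * d t).
  by apply: min_le; rewrite eq_sym.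
have sqrt_le : Num.sqrt (d s * d t) <= rho.
  by rewrite -(ger0_norm (ltW rho_gt0)) -sqrtr_sqr ler_wsqrtr.
split; first exact: le_trans sqrt_le.
split=> [rho_min|[k dk]].
  have {}/eq_rho[y_s y_t] : rho ^+ 2 = d s * d t.
    have -> : rho = Num.sqrt (d s * d t).
      by apply/le_anti; rewrite sqrt_le andbT rho_min.
    by rewrite sqr_sqrtr // mulr_ge0 // ltW.
  have [yst|yst] := eqVneq (y s) (y t).
    exists rho => i; rewrite -/(d i).
    have y_const j : y j = y s.
      by have [->//|/y_s ->] := eqVneq j s.
    apply: (mulIf (lt0r_neq0 (mulr_gt0 (x_gt0 i) (y_gt0 s)))).
    rewrite mulrA -Ax -{2}(y_const i) -Axy mulr_suml.
    by apply: eq_bigr => j _; rewrite y_const mulrA.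
  have all_st i : i = s \/ i = t.
    have [->|/y_s ys] := eqVneq i s; first by left.
    have [->|/y_t yt] := eqVneq i t; first by right.
    by rewrite -yt ys eqxx in yst.
  exists (d s) => i; case: (all_st i) => -> //; apply/esym.
  by apply: two_vertices_regular; rewrite // eq_sym.
have k_ge0 : 0 <= k by rewrite -(dk s) ltW ?d_gt0.
rewrite minE !dk -expr2 sqrtr_sqr ger0_norm //.
have xz_gt0 : 0 < \sum_i x i * z 0 i.
  rewrite (bigD1 s) //= ltr_wpDr ?mulr_gt0 // sumr_ge0 // => i _.
  by rewrite mulr_ge0 // ltW.
(* Both sides times sum_i x_i z_i are the value x A z of the bilinear form. *)
apply: (mulIf (lt0r_neq0 xz_gt0)).
transitivity (\sum_i \sum_j x i * (A i j * z 0 j)).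
  by rewrite mulr_sumr; apply: eq_bigr => i _; rewrite -mulr_sumr Az; ring.
rewrite exchange_big mulr_sumr; apply: eq_bigr => j _ /=.
rewrite mulrA -(dk j) -Ax mulr_suml; apply: eq_bigr => i _.
by rewrite -[in LHS]symA mxE; ring.
Qed.
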